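(* Let $R$ be a semiprime left Noetherian ring and let $\sigma$ be a ring endomorphism of $R$ with large image. Then $\sigma$ is a monomorphism.
   Context: Rings are associative and unital, and ring endomorphisms preserve $1$. A monomorphism is an injective ring homomorphism. A left ideal of a ring is essential if it has nonzero intersection with every nonzero left ideal of the ring. An endomorphism $\sigma$ of $R$ has large image if $\sigma(R)$ contains an essential left ideal of $R$. *)

(* Defs.v *)
From mathcomp Require Import all_boot all_algebra.
From mathcomp Require Import boolp classical_sets.

Set Implicit Arguments.
Unset Strict Implicit.
Unset Printing Implicit Defensive.

Import GRing.Theory.
Local Open Scope classical_set_scope.
Local Open Scope ring_scope.

(* Ideals are Prop-valued sets, so that no decidability is built in, and they
   need not be proper.  Rings are noncommutative and possibly zero
   (pzRingType). *)

(* Closure under opposites follows from the last clause with a = -1. *)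
Definition left_ideal (R : pzRingType) (I : set R) : Prop :=
  [/\ I 0,
      forall x y, I x -> I y -> I (x + y)
    & forall a x, I x -> I (a * x)].

Definition two_sided_ideal (R : pzRingType) (I : set R) : Prop :=
  left_ideal I /\ forall x a, I x -> I (x * a).

(* The product I J: finite sums of products x y with x in I and y in J. *)
Definition ideal_mul (R : pzRingType) (I J : set R) : set R :=
  [set z | exists n (x y : 'I_n -> R),
      [/\ forall i, I (x i), forall i, J (y i) & z = \sum_(i < n) x i * y i]].

Definition ideal_exp (R : pzRingType) (I : set R) (n : nat) : set R :=
  iter n (ideal_mul I) [set: R].

Definition nilpotent_ideal (R : pzRingType) (I : set R) : Prop :=
  exists n : nat, ideal_exp I n = [set 0].

Definition semiprime_ring (R : pzRingType) : Prop :=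
  forall I : set R, two_sided_ideal I -> nilpotent_ideal I -> I = [set 0].

(* The ascending chain condition on left ideals. *)
Definition left_noetherian (R : pzRingType) : Prop :=
  forall I : nat -> set R,
    (forall n, left_ideal (I n)) ->
    (forall n, I n `<=` I n.+1) ->
    exists N, forall n, (N <= n)%N -> I n = I N.

Definition essential_left_ideal (R : pzRingType) (I : set R) : Prop :=
  left_ideal I /\
  forall J : set R, left_ideal J -> J <> [set 0] -> I `&` J <> [set 0].

Definition large_image (R : pzRingType) (sigma : {rmorphism R -> R}) : Prop :=
  exists I : set R, essential_left_ideal I /\ I `<=` range sigma.

(* Main.v *)
(* Put l(J) for the left annihilator of J.  The minimal primes of R are the
   p = l(J) for which every nonzero ideal inside J has the same left annihilator
   as J.  Let I be an essential left ideal inside sigma(R); it contains d with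
   l(d) = 0, and x |-> x d embeds R, as a module over S = sigma(R), into S, which
   is isomorphic to R / ker sigma.  Hence R is a noetherian S-module, and by
   transitivity it is noetherian over every sigma^n(R).  If p is a minimal prime
   contained in sigma^-m(p), this forces sigma^-m(p) = p: otherwise sigma^-m(p)
   would contain an element c regular modulo p, whose powers would span an
   infinite direct sum over T = sigma^mN(R), N large, modulo p.  Finally
   sigma^-1(p) is prime, so it contains a minimal prime; iterating gives a
   sequence of minimal primes that must repeat.  As the preimages of distinct
   minimal primes are incomparable, the repetition propagates back to the first
   term, so every minimal prime has the form sigma^-1(q) and contains
   ker sigma.  The minimal primes have zero intersection. *)
Require Import Defs.
From mathcomp Require Import all_boot all_algebra.
From mathcomp Require Import boolp classical_sets.

Set Implicit Arguments.
Unset Strict Implicit.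
Unset Printing Implicit Defensive.

Import GRing.Theory.
Local Open Scope classical_set_scope.
Local Open Scope ring_scope.

(** * Noetherian conditions relative to a set of scalars *)

Definition submod (R : pzRingType) (T M : set R) : Prop :=
  [/\ M 0, forall x y, M x -> M y -> M (x + y)
    & forall t x, T t -> M x -> M (t * x)].

Definition noeth (R : pzRingType) (T N : set R) : Prop :=
  forall M : nat -> set R,
    (forall n, submod T (M n)) -> (forall n, M n `<=` N) ->
    (forall n, M n `<=` M n.+1) ->
    exists n, forall m, (n <= m)%N -> M m `<=` M n.

Lemma chain_mono (T : Type) (M : nat -> set T) :
  (forall n, M n `<=` M n.+1) -> forall m n, (m <= n)%N -> M m `<=` M n.
Proof.
move=> h m n /subnK <-; elim: (n - m)%N => [|k IH] //=.
exact: subset_trans IH (h _).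
Qed.

Lemma left_ideal_submod (R : pzRingType) (X : set R) :
  left_ideal X <-> submod setT X.
Proof. by split=> -[x0 xD xM]; split=> // a x; [move=> _|]; apply: xM. Qed.

Lemma noeth_setT (R : pzRingType) : left_noetherian R -> noeth (@setT R) setT.
Proof.
move=> nR M sM _ cM.
have [N hN] := nR M (fun n => (left_ideal_submod _).2 (sM n)) cM.
by exists N => m /hN ->.
Qed.

Lemma noeth_max (R : pzRingType) (T N : set R) (P : set R -> Prop) :
  noeth T N -> (exists A, P A) ->
  (forall A, P A -> submod T A /\ A `<=` N) ->
  exists2 A, P A & forall B, P B -> A `<=` B -> B `<=` A.
Proof.
move=> nN [A0 pA0] hP; apply: contrapT => hno.
have ex A : exists B, P A -> [/\ P B, A `<=` B & ~ B `<=` A].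
  have [pA|npA] := pselect (P A); last by exists A.
  apply: contrapT => h; apply: hno; exists A => // B pB AB.
  by apply: contrapT => BA; apply: h; exists B => _; split.
have [f hf] := choice ex.
pose M n := iter n f A0.
have pM n : P (M n) by elim: n => //= n IH; case: (hf _ IH).
have [||n|n hn] := nN M.
- by move=> n; case: (hP _ (pM n)).
- by move=> n; case: (hP _ (pM n)).
- by case: (hf _ (pM n)).
by case: (hf _ (pM n)) => _ _; apply; apply: (hn n.+1).
Qed.

Lemma left_ideal_max (R : pzRingType) (P : set R -> Prop) :
  left_noetherian R -> (exists A, P A) -> (forall A, P A -> left_ideal A) ->
  exists2 A, P A & forall B, P B -> A `<=` B -> B `<=` A.
Proof.
move=> nR eP hP; apply: (noeth_max (noeth_setT nR)) => // A /hP /left_ideal_submod.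
by split.
Qed.

(** * Regular elements in semiprime left noetherian rings *)

(** The ideal generated by [x], taken as an intersection to avoid sums, has square zero. *)
Lemma semiprime_elt (R : pzRingType) (x : R) :
  semiprime_ring R -> (forall r, x * r * x = 0) -> x = 0.
Proof.
move=> sR xRx.
pose J := [set y | forall A, two_sided_ideal A -> A x -> A y].
have Jx : J x by [].
have JJ y z r : J y -> J z -> y * r * z = 0.
  move=> Jy Jz.
  have yRx s : y * s * x = 0.
    move: s; apply: (Jy [set y | forall s, y * s * x = 0]) => //.
    split; [split=> /=|move=> a b /= h s].
    - by move=> s; rewrite !mul0r.
    - by move=> a b ha hb s; rewrite !mulrDl ha hb addr0.
    - by move=> a b hb s; rewrite -!mulrA (mulrA b) hb mulr0.
    - by rewrite -(mulrA a) h.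
  move: r; apply: (Jz [set z | forall s, y * s * z = 0]) => //.
  split; [split=> /=|move=> a b /= h s].
  - by move=> s; rewrite mulr0.
  - by move=> a b ha hb s; rewrite mulrDr ha hb addr0.
  - by move=> a b hb s; rewrite mulrA -(mulrA y) hb.
  - by rewrite mulrA h mul0r.
have iJ : two_sided_ideal J.
  split; [split|].
  - by move=> A [[h _ _] _] _.
  - by move=> a b ha hb A hA Ax; have [[_ hD _] _] := hA; apply: hD; [apply: ha|apply: hb].
  - by move=> a b hb A hA Ax; have [[_ _ hM] _] := hA; apply: hM; apply: hb.
  - by move=> a b ha A hA Ax; have [_ hM] := hA; apply: hM; apply: ha.
suff J0 : J = [set 0] by move: Jx; rewrite J0.
apply: sR => //; exists 2%N; apply/seteqP; split=> [z|z ->] /=.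
  move=> [n [a [b [ha hb ->]]]]; apply: big1 => i _.
  have [m [a' [b' [ha' _ ->]]]] := hb i.
  rewrite mulr_sumr; apply: big1 => j _.
  by rewrite mulrA -[a i]mulr1 (JJ _ _ _ (ha i) (ha' j)) mul0r.
by exists 0%N, (fun=> 0), (fun=> 0); split=> [[]|[]|] //; rewrite big_ord0.
Qed.

Definition lann (R : pzRingType) (A : set R) : set R :=
  [set x | forall y, A y -> x * y = 0].

Lemma lann_left_ideal (R : pzRingType) (A : set R) : left_ideal (lann A).
Proof.
split=> [y _|x y hx hy z Az|a x hx z Az]; rewrite ?mul0r //.
  by rewrite mulrDl hx // hy // addr0.
by rewrite -mulrA hx // mulr0.
Qed.

(* Take a in x R nonzero with l(a) maximal, then r with a r a <> 0: maximality
   gives l(a r a) = l(a), and a r is the required element. *)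
Lemma right_quasi_regular (R : pzRingType) (x : R) :
  semiprime_ring R -> left_noetherian R -> x <> 0 ->
  exists2 u, x * u <> 0 & forall y, y * (x * u) * (x * u) = 0 -> y * (x * u) = 0.
Proof.
move=> sR nR x0.
pose P A := exists2 s, x * s <> 0 & A = lann [set x * s].
have [||_ [s a0 ->] hmax] := @left_ideal_max R P nR.
- by exists (lann [set x]), 1; rewrite mulr1.
- by move=> _ [s _ ->]; apply: lann_left_ideal.
set a := x * s in a0 hmax.
have [r ara] : exists r, a * r * a <> 0.
  apply: contrapT => h; apply: a0; apply: (semiprime_elt sR) => r.
  by apply: contrapT => h'; apply: h; exists r.
have key y : y * (a * r * a) = 0 -> y * a = 0.
  move=> hy; apply: (hmax (lann [set a * r * a])) => //.
  - by exists (s * r * a); have -> : x * (s * r * a) = a * r * a by rewrite /a !mulrA.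
  - by move=> z hz _ ->; rewrite -mulrA mulrA hz // mul0r.
  - by move=> _ ->.
have e : x * (s * r) = a * r by rewrite mulrA.
exists (s * r) => [|y]; rewrite e => h.
  by apply: ara; rewrite h mul0r.
have /key : y * (a * r) * (a * r * a) = 0 by rewrite 2!mulrA -(mulrA _ a r) h mul0r.
by rewrite -mulrA => /key h'; rewrite mulrA h' mul0r.
Qed.

(** With [b = x * u] from [right_quasi_regular] and [c = u * b * x], right multiplication by [u]
    turns [c * c] into [u * b ^+ 4]. *)
Lemma left_quasi_regular (R : pzRingType) (X : set R) :
  semiprime_ring R -> left_noetherian R -> left_ideal X ->
  (exists2 x, X x & x <> 0) ->
  exists c, [/\ X c, c <> 0 & forall y, y * c * c = 0 -> y * c = 0].
Proof.
move=> sR nR [_ _ XM] [x Xx /(right_quasi_regular sR nR)] [u].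
move eb: (x * u) => b b0 hb; exists (u * b * x); split.
- exact: XM.
- have e : x * (u * b * x) * u = b * b * b by rewrite -eb !mulrA.
  move=> h; apply: b0; rewrite -[b]mul1r; apply/hb/hb; rewrite mul1r -e h.
  by rewrite mulr0 mul0r.
- move=> y h; suff h' : y * u * b = 0 by rewrite !mulrA h' mul0r.
  do 3 apply: (hb); have := congr1 (fun z => z * u) h; rewrite mul0r => <-.
  by rewrite -eb !mulrA.
Qed.

(* Take A maximal among the left ideals in X with an element c such that
   l(c ^+ 2) = l(c) and l(c) meets A trivially: a nonzero b in X with b c = 0 and
   l(b ^+ 2) = l(b) would allow replacing A and c by A + R b and c + b. *)
Lemma left_regular_in (R : pzRingType) (X : set R) :
  semiprime_ring R -> left_noetherian R -> left_ideal X ->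
  exists2 c, X c & forall y, X y -> y * c = 0 -> y = 0.
Proof.
move=> sR nR iX; have [X0 XD XM] := iX.
pose P A := [/\ left_ideal A, A `<=` X & exists c, [/\ A c,
  forall y, y * c * c = 0 -> y * c = 0 & forall y, A y -> y * c = 0 -> y = 0]].
have [||A [[A0 AD AM] AX [c [Ac cc cA]]] Amax] := @left_ideal_max R P nR.
- exists [set 0]; split; first split=> //=.
  + by move=> x y -> ->; rewrite addr0.
  + by move=> a x ->; rewrite mulr0.
  + by move=> _ ->.
  + by exists 0; split=> // y; rewrite !mulr0.
- by move=> B [].
exists c; first exact: AX.
move=> y Xy yc0; apply: contrapT => y0.
have [| |b [[Xb bc] b0 bb]] := @left_quasi_regular R (X `&` lann [set c]) sR nR.
- have [l0 lD lM] := lann_left_ideal [set c].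
  by split=> [|u v [? ?] [? ?]|a u [? ?]]; split; auto.
- by exists y => //; split=> // _ ->.
have {}bc : b * c = 0 by apply: bc.
pose c' := c + b; pose B := [set z | exists2 a, A a & exists r, z = a + r * b].
(* Since [b * c = 0], multiplying by [c] on the right leaves [z * c * c = 0]. *)
have c'P z : z * c' = 0 -> z * c = 0 /\ z * b = 0.
  move=> h; have zc : z * c = 0.
    apply: cc; have := congr1 (fun t => t * c) h.
    by rewrite mul0r mulrDr mulrDl -(mulrA z b) bc mulr0 addr0.
  by move: h; rewrite mulrDr zc add0r.
have AB : A `<=` B by move=> a Aa; exists a => //; exists 0; rewrite mul0r addr0.
have Bb : B b by exists 0 => //; exists 1; rewrite mul1r add0r.
have pB : P B.
  split; first split.
  - exact: AB.
  - move=> _ _ [a Aa [r ->]] [a' Aa' [r' ->]]; exists (a + a'); first exact: AD.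
    by exists (r + r'); rewrite mulrDl addrACA.
  - move=> t _ [a Aa [r ->]]; exists (t * a); first exact: AM.
    by exists (t * r); rewrite mulrDr mulrA.
  - by move=> _ [a Aa [r ->]]; apply: XD; [apply: AX|apply: XM].
  - exists c'; split.
    + by exists c => //; exists 1; rewrite mul1r.
    + move=> z /c'P [h1 h2].
      have zc : z * c = 0.
        by apply: cc; move: h1; rewrite mulrDr mulrDl -(mulrA z b) bc mulr0 addr0.
      rewrite mulrDr zc add0r; apply: bb.
      by move: h2; rewrite mulrDr zc add0r.
    + move=> _ [a Aa [r ->]] /c'P [h1 h2].
      have a0 : a = 0.
        by apply: cA => //; move: h1; rewrite mulrDl -mulrA bc mulr0 addr0.
      by move: h2; rewrite a0 !add0r; apply: bb.
by apply: b0; apply: cA => //; apply: (Amax B).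
Qed.

(** * Annihilators and essential left ideals *)

Lemma lann_right (R : pzRingType) (J : set R) (x y : R) :
  semiprime_ring R -> left_ideal J -> lann J x -> J y -> y * x = 0.
Proof.
move=> sR [_ _ JM] xJ Jy; apply: (semiprime_elt sR) => r.
by rewrite -(mulrA y x) -mulrA -(mulrA x) (mulrA r) (mulrA x) xJ ?mul0r ?mulr0 //; apply: JM.
Qed.

Lemma ideal_setI (R : pzRingType) (A B : set R) :
  two_sided_ideal A -> two_sided_ideal B -> two_sided_ideal (A `&` B).
Proof.
move=> [[A0 AD AM] AMr] [[B0 BD BM] BMr]; split; first split=> //.
- by move=> x y [? ?] [? ?]; split; [apply: AD|apply: BD].
- by move=> a x [? ?]; split; [apply: AM|apply: BM].
- by move=> x a [? ?]; split; [apply: AMr|apply: BMr].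
Qed.

Lemma lann_ideal (R : pzRingType) (J : set R) :
  left_ideal J -> two_sided_ideal (lann J).
Proof.
move=> [_ _ JM]; split; first exact: lann_left_ideal.
by move=> x a xJ y Jy; rewrite -mulrA; apply/xJ/JM.
Qed.

Lemma preim_ideal (R : pzRingType) (f : {rmorphism R -> R}) (A : set R) :
  two_sided_ideal A -> two_sided_ideal (f @^-1` A).
Proof.
move=> [[A0 AD AM] AMr]; split; [split|] => /=.
- by rewrite rmorph0.
- by move=> x y Ax Ay; rewrite rmorphD; apply: AD.
- by move=> a x Ax; rewrite rmorphM; apply: AM.
- by move=> x a Ax; rewrite rmorphM; apply: AMr.
Qed.

Lemma essential_meet (R : pzRingType) (I L : set R) :
  essential_left_ideal I -> left_ideal L -> (exists2 x, L x & x <> 0) ->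
  exists x, [/\ I x, L x & x <> 0].
Proof.
move=> [iI eI] iL [x Lx x0]; apply: contrapT => h.
apply: (eI L) => //; first by move=> L0; apply: x0; move: Lx; rewrite L0.
apply/seteqP; split=> [y [Iy Ly]|_ ->] /=.
  by apply: contrapT => y0; apply: h; exists y.
by split; [case: iI|case: iL].
Qed.

(** Take [d] regular within [I]: its left annihilator meets [I] trivially, hence is zero. *)
Lemma essential_left_regular (R : pzRingType) (I : set R) :
  semiprime_ring R -> left_noetherian R -> essential_left_ideal I ->
  exists2 d, I d & forall y, y * d = 0 -> y = 0.
Proof.
move=> sR nR eI; have [d Id hd] := left_regular_in sR nR eI.1.
exists d => // y yd; apply: contrapT => y0.
have [||z [Iz zd z0]] := @essential_meet _ _ (lann [set d]) eI.
- exact: lann_left_ideal.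
- by exists y => // _ ->.
by apply: z0; apply: hd => //; apply: zd.
Qed.

(* The left singular ideal vanishes. *)
Lemma essential_right_faithful (R : pzRingType) (I : set R) (z : R) :
  semiprime_ring R -> left_noetherian R -> essential_left_ideal I ->
  (forall x, I x -> x * z = 0) -> z = 0.
Proof.
move=> sR nR eI Iz; apply: contrapT => /(right_quasi_regular sR nR)[u a0 ha].
have [||y [Iy [r yE] y0]] :=
    @essential_meet _ _ [set y | exists r, y = r * (z * u)] eI.
- split=> [|x y [r ->] [s ->]|b x [r ->]]; first by exists 0; rewrite mul0r.
  + by exists (r + s); rewrite mulrDl.
  + by exists (b * r); rewrite mulrA.
- by exists (z * u) => //; exists 1; rewrite mul1r.
by apply: y0; rewrite yE; apply: ha; rewrite -yE mulrA Iz // mul0r.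
Qed.

(** * Atomic ideals and minimal primes *)

(* The left annihilators of the atomic ideals are the minimal primes of a
   semiprime left noetherian ring. *)
Definition atomic_ideal (R : pzRingType) (J : set R) : Prop :=
  [/\ two_sided_ideal J, exists2 x, J x & x <> 0
    & forall J', two_sided_ideal J' -> J' `<=` J ->
        (exists2 x, J' x & x <> 0) -> lann J' `<=` lann J].

Lemma lann_anti (R : pzRingType) (A B : set R) :
  A `<=` B -> lann B `<=` lann A.
Proof. by move=> AB x xB y /AB; apply: xB. Qed.

(** Choose [lann J] maximal; annihilators only grow on smaller ideals. *)
Lemma atomic_exists (R : pzRingType) (X : set R) :
  left_noetherian R -> two_sided_ideal X -> (exists2 x, X x & x <> 0) ->
  exists2 J, atomic_ideal J & J `<=` X.
Proof.
move=> nR iX X0.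
pose P A := exists J, [/\ two_sided_ideal J, J `<=` X,
  exists2 x, J x & x <> 0 & A = lann J].
have [||_ [J [iJ JX J0 ->]] Jmax] := @left_ideal_max R P nR.
- by exists (lann X), X; split.
- by move=> _ [J [_ _ _ ->]]; apply: lann_left_ideal.
exists J => //; split=> // J' iJ' J'J J'0; apply: Jmax; last exact: lann_anti.
by exists J'; split=> //; apply: subset_trans JX.
Qed.

Lemma ideal_lann_trivial (R : pzRingType) (J : set R) (x : R) :
  semiprime_ring R -> left_ideal J -> lann J x -> J x -> x = 0.
Proof.
move=> sR [_ _ JM] xJ Jx; apply: (semiprime_elt sR) => r.
by rewrite -mulrA; apply/xJ/JM.
Qed.

(** If some [y * j] is nonzero, it lies in the ideal [N], whose annihilator contains [x] and is
    contained in [lann J]. *)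
Lemma atomic_prime (R : pzRingType) (J : set R) (x y : R) :
  atomic_ideal J -> (forall r, lann J (x * r * y)) -> lann J x \/ lann J y.
Proof.
move=> [[[J0 JD JM] JMr] _ Jmin] xRy.
have [Jy|nJy] := pselect (lann J y); [by right|left].
have [j Jj yj0] : exists2 j, J j & y * j <> 0.
  apply: contrapT => h; apply: nJy => j Jj.
  by apply: contrapT => yj; apply: h; exists j.
pose N := [set z | J z /\ forall r, x * r * z = 0].
have iN : two_sided_ideal N.
  split; [split|] => /=.
  - by split=> // r; rewrite mulr0.
  - move=> a b [Ja ha] [Jb hb]; split; first exact: JD.
    by move=> r; rewrite mulrDr ha hb addr0.
  - by move=> a b [Jb hb]; split; [exact: JM|move=> r; rewrite mulrA -(mulrA x)].
  - by move=> b a [Jb hb]; split; [exact: JMr|move=> r; rewrite mulrA hb mul0r].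
apply: (Jmin N) => //; first by move=> z [].
  by exists (y * j) => //; split; [exact: JM|move=> r; rewrite mulrA xRy].
by move=> z [_ /(_ 1)]; rewrite mulr1.
Qed.

(** If the ideals meet, [lann J'] annihilates the intersection, so it lies in [lann J]. Otherwise
    [J'] annihilates [J], hence itself. *)
Lemma atomic_incomparable (R : pzRingType) (J J' : set R) :
  semiprime_ring R -> atomic_ideal J -> atomic_ideal J' ->
  lann J `<=` lann J' -> lann J = lann J'.
Proof.
move=> sR [iJ _ Jmin] [iJ' [x J'x x0] Jmin'] sub; apply/seteqP; split=> //.
have [JJ'0|JJ'0] := pselect (exists2 x, (J `&` J') x & x <> 0).
  apply: subset_trans (Jmin _ (ideal_setI iJ iJ') _ JJ'0); last by move=> ? [].
  by apply: lann_anti => ? [].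
exfalso; apply: x0; apply: (ideal_lann_trivial sR iJ'.1) => //.
apply: sub => y Jy; apply: contrapT => xy0; apply: JJ'0; exists (x * y) => //.
by case: iJ iJ' => [[_ _ JM] _] [_ JMr]; split; auto.
Qed.

(** A nonzero product lies in the intersection, whose annihilator would equal both. *)
Lemma atomic_orthogonal (R : pzRingType) (J J' : set R) :
  atomic_ideal J -> atomic_ideal J' -> lann J <> lann J' ->
  forall x y, J x -> J' y -> x * y = 0.
Proof.
move=> [iJ _ Jmin] [iJ' _ Jmin'] ne x y Jx J'y; apply: contrapT => xy0.
have i := ideal_setI iJ iJ'.
have n : exists2 x, (J `&` J') x & x <> 0.
  by exists (x * y) => //; case: iJ iJ' => _ JMr [[_ _ JM] _]; split; auto.
apply: ne; apply/seteqP; split.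
- by apply: subset_trans (Jmin' _ i _ n) => [|? []] //; apply: lann_anti => ? [].
- by apply: subset_trans (Jmin _ i _ n) => [|? []] //; apply: lann_anti => ? [].
Qed.

(* Take X not contained in q with l(X) maximal, and J atomic in X.  If l(J) were
   not contained in q, then X could be replaced by its intersection with l(J),
   so l(X) would contain J. *)
Lemma prime_contains_atomic (R : pzRingType) (q : set R) :
  semiprime_ring R -> left_noetherian R -> two_sided_ideal q -> ~ q 1 ->
  (forall x y, (forall r, q (x * r * y)) -> q x \/ q y) ->
  exists2 J, atomic_ideal J & lann J `<=` q.
Proof.
move=> sR nR iq q1 qpr.
pose P A := exists X, [/\ two_sided_ideal X, exists2 x, X x & ~ q x & A = lann X].
have [||_ [X [iX [x Xx qx] ->]] Xmax] := @left_ideal_max R P nR.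
- by exists (lann setT), setT; split=> //; exists 1.
- by move=> _ [X [_ _ ->]]; apply: lann_left_ideal.
have [|J aJ JX] := atomic_exists nR iX.
  by exists x => // x0; apply: qx; rewrite x0; case: iq => [[]].
have [iJ [j Jj j0] _] := aJ.
exists J => // y yJ; apply: contrapT => qy; apply: j0.
have ip := lann_ideal iJ.1.
apply: (ideal_lann_trivial sR iJ.1) => // k Jk.
apply: (Xmax (lann (X `&` lann J))); last by apply: JX.
- exists (X `&` lann J); split=> //; first exact: ideal_setI.
  have [r qr] : exists r, ~ q (x * r * y).
    apply: contrapT => h; case: (qpr x y) => // r.
    by apply: contrapT => h'; apply: h; exists r.
  exists (x * r * y) => //; case: iX ip => _ XMr [[_ _ pM] _].
  by split; [apply/XMr/XMr|apply: pM].
- by apply: lann_anti => ? [].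
- by move=> z [_ zJ]; apply: (lann_right sR iJ.1).
Qed.

(** * Preimages of minimal primes under a map with large image *)

(** As [f] need not be onto, an arbitrary [r] is replaced by [r * i] with [i] in [I], which is an
    image. *)
Lemma preim_atomic_prime (R : pzRingType) (f : {rmorphism R -> R})
    (I J : set R) (x y : R) :
  semiprime_ring R -> left_noetherian R -> essential_left_ideal I ->
  I `<=` range f -> atomic_ideal J ->
  (forall r, lann J (f (x * r * y))) -> lann J (f x) \/ lann J (f y).
Proof.
move=> sR nR eI If aJ xRy; have [iI _] := eI; have [_ _ IM] := iI.
have [iJ _ _] := aJ; have [_ _ pM] := lann_left_ideal J.
have faithful u : (forall i, I i -> lann J (i * u)) -> lann J u.
  move=> h j Jj; apply: (essential_right_faithful sR nR eI) => i Ii.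
  by rewrite mulrA h.
have [h|h] := pselect (forall i, I i -> lann J (i * f x)).
  by left; apply: faithful.
right; apply: faithful => i Ii.
have [i' Ii' ni'] : exists2 i, I i & ~ lann J (i * f x).
  apply: contrapT => h'; apply: h => k Ik.
  by apply: contrapT => hk; apply: h'; exists k.
case: (@atomic_prime _ J (i' * f x) (i * f y)) => // r.
have [s _ fs] := If _ (IM r _ Ii).
have := xRy s; rewrite !rmorphM fs => /(pM i'); rewrite !mulrA.
by [].
Qed.

(** For a nonzero [i] in both [I] and [J'], every [y * r * i] is an image, so [sub] puts it in the
    prime [lann J'], which omits [i]. *)
Lemma preim_atomic_incomparable (R : pzRingType) (f : {rmorphism R -> R})
    (I J J' : set R) :
  semiprime_ring R -> essential_left_ideal I ->
  I `<=` range f -> atomic_ideal J -> atomic_ideal J' ->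
  f @^-1` lann J `<=` f @^-1` lann J' -> lann J = lann J'.
Proof.
move=> sR eI If aJ aJ' sub; apply: atomic_incomparable => // y yJ.
have [iJ _ _] := aJ; have [iJ' J'0 _] := aJ'.
have [i [Ii J'i i0]] := essential_meet eI iJ'.1 J'0.
have [_ pMr] := lann_ideal iJ.1; have [_ _ IM] := eI.1.
case: (@atomic_prime _ J' y i aJ') => [r|//|iJ'0].
- have [s _ fs] := If _ (IM (y * r) _ Ii).
  by rewrite -fs; apply: sub; rewrite /preimage /= fs -mulrA; apply: pMr.
- by case: i0; apply: (ideal_lann_trivial sR iJ'.1).
Qed.

(** * Noetherianity over images of iterates *)

Lemma iter_rmorphism (R : pzRingType) (f : {rmorphism R -> R}) (n : nat) :
  exists g : {rmorphism R -> R}, iter n f =1 g.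
Proof.
elim: n => [|n [g fg]]; first by exists idfun.
by exists (f \o g) => x /=; rewrite fg.
Qed.

Lemma noeth_large_image (R : pzRingType) (f : {rmorphism R -> R}) (I : set R) :
  semiprime_ring R -> left_noetherian R -> essential_left_ideal I ->
  I `<=` range f -> noeth (range f) setT.
Proof.
move=> sR nR eI If M sM _ cM; have [d Id dreg] := essential_left_regular sR nR eI.
have [_ _ IM] := eI.1.
pose A k := [set r | exists2 x, M k x & f r = x * d].
have [|//||n hn] := noeth_setT nR (M := A).
- move=> k; have [M0 MD MM] := sM k; split=> /=.
  + by exists 0; rewrite // rmorph0 mul0r.
  + move=> r s [x Mx fr] [y My fs]; exists (x + y); first exact: MD.
    by rewrite rmorphD fr fs mulrDl.
  + move=> t r _ [x Mx fr]; exists (f t * x); first by apply: MM => //; exists t.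
    by rewrite rmorphM fr mulrA.
- by move=> k r [x /cM Mx fr]; exists x.
exists n => m nm x Mx; have [r _ fr] := If _ (IM x _ Id).
have [|y My fy] := hn _ nm r; first by exists x.
suff -> : x = y by [].
by apply/eqP; rewrite -subr_eq0; apply/eqP/dreg; rewrite mulrBl -fr fy subrr.
Qed.

Lemma noeth_image (R : pzRingType) (f : {rmorphism R -> R}) (T : set R) :
  noeth T setT -> noeth (f @` T) (range f).
Proof.
move=> nT M sM Mf cM; have [|//||n hn] := nT (fun k => f @^-1` M k).
- move=> k; have [M0 MD MM] := sM k; split; rewrite /preimage /=.
  + by rewrite rmorph0.
  + by move=> x y; rewrite rmorphD; apply: MD.
  + by move=> t x Tt; rewrite rmorphM; apply: MM; exists t.
- by move=> k x /cM.
by exists n => m nm y My; have [x _ fx] := Mf _ _ My; subst y; apply: (hn m).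
Qed.

(* The largest S-submodule that is T-noetherian cannot omit an element x, since
   adjoining S x keeps it T-noetherian. *)
Lemma noeth_trans (R : pzRingType) (S T : set R) :
  submod S S -> S 1 -> S (-1) -> T `<=` S -> T (-1) ->
  noeth S setT -> noeth T S -> noeth T setT.
Proof.
move=> [S0 SD SM] S1 SN1 TS TN1 nS nTS.
pose P N := submod S N /\ noeth T N.
have [||N [[N0 ND NM] nN] Nmax] := noeth_max nS (P := P).
- exists [set 0]; split; first split=> //=.
  + by move=> x y -> ->; rewrite addr0.
  + by move=> t x _ ->; rewrite mulr0.
  + move=> M sM M0 _; exists 0%N => m _ x /M0 ->.
    by case: (sM 0%N).
- by move=> N [].
suff NT : N = setT by rewrite -NT.
apply/seteqP; split=> // x _.
pose N' := [set z | exists2 y, N y & exists2 s, S s & z = y + s * x].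
apply: (Nmax N'); last 1 first.
- by exists 0 => //; exists 1; rewrite // mul1r add0r.
- split; first split.
  + by exists 0 => //; exists 0; rewrite // mul0r addr0.
  + move=> _ _ [y Ny [s Ss ->]] [y' Ny' [s' Ss' ->]].
    exists (y + y'); first exact: ND.
    by exists (s + s'); [apply: SD|rewrite mulrDl addrACA].
  + move=> t _ St [y Ny [s Ss ->]]; exists (t * y); first exact: NM.
    by exists (t * s); [apply: SM|rewrite mulrDr mulrA].
  move=> M sM MN' cM.
  have [|||n1 hn1] := nN (fun k => M k `&` N).
  - move=> k; have [M0 MD MM] := sM k; split=> //.
    + by move=> a b [? ?] [? ?]; split; [apply: MD|apply: ND].
    + by move=> t a Tt [? ?]; split; [apply: MM|apply: NM => //; apply: TS].
  - by move=> k ? [].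
  - by move=> k a [/cM Ma Na].
  (* The coefficients of [x] occurring in [M k]; with the trace of [M k] on [N] they control the
     chain. *)
  have [|||n2 hn2] := nTS (fun k => [set s | S s /\ exists2 y, N y & M k (y + s * x)]).
  - move=> k; have [M0 MD MM] := sM k; split=> /=.
    + by split=> //; exists 0; rewrite // mul0r addr0.
    + move=> a b [Sa [y Ny My]] [Sb [z Nz Mz]]; split; first exact: SD.
      by exists (y + z); [apply: ND|rewrite mulrDl addrACA; apply: MD].
    + move=> t a Tt [Sa [y Ny My]]; split; first by apply: SM => //; apply: TS.
      exists (t * y); first by apply: NM => //; apply: TS.
      by rewrite -mulrA -mulrDr; apply: MM.
  - by move=> k ? [].
  - by move=> k s [Ss [y Ny /cM My]]; split=> //; exists y.
  exists (maxn n1 n2) => m; rewrite geq_max => /andP[n1m n2m] z Mz.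
  have [y Ny [s Ss zE]] := MN' _ _ Mz.
  have [|_ [y' Ny' My']] := hn2 _ n2m s.
    by split=> //; exists y; rewrite -?zE.
  have [M0 MD MM] := sM (maxn n1 n2); have [_ mD mM] := sM m.
  have -> : z = (y - y') + (y' + s * x) by rewrite addrA subrK.
  apply: MD; last by apply: (chain_mono cM (leq_maxr _ _)).
  apply: (chain_mono cM (leq_maxl _ n2)).
  suff [] : (M n1 `&` N) (y - y') by [].
  apply: (hn1 m) => //; split; last by apply: ND => //; rewrite -mulN1r; apply: NM.
  have -> : y - y' = z + -1 * (y' + s * x).
    by rewrite mulN1r opprD zE addrACA subrr addr0.
  apply: mD => //; apply: mM => //; apply: (chain_mono cM n2m).
  exact: My'.
- by move=> y Ny; exists y => //; exists 0; rewrite // mul0r addr0.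
Qed.

(** Each new image is [f] of the previous one, so transitivity through [range f] applies. *)
Lemma noeth_iter (R : pzRingType) (f : {rmorphism R -> R}) :
  left_noetherian R -> noeth (range f) setT ->
  forall n (g : {rmorphism R -> R}), iter n f =1 g -> noeth (range g) setT.
Proof.
move=> nR nf; elim=> [|n IH] g fg.
  suff -> : range g = setT by apply: noeth_setT.
  by apply/seteqP; split=> // x _; exists x; rewrite // -fg.
have [h fh] := iter_rmorphism f n.
have -> : range g = f @` range h.
  apply/seteqP; split=> [_ [x _ <-]|_ [_ [x _ <-] <-]].
    by exists (h x); [exists x|rewrite -fg /= fh].
  by exists x; rewrite // -fg /= fh.
apply: (@noeth_trans _ (range f)) => //.
- split; first by exists 0; rewrite ?rmorph0.
  + by move=> _ _ [x _ <-] [y _ <-]; exists (x + y); rewrite ?rmorphD.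
  + by move=> _ _ [x _ <-] [y _ <-]; exists (x * y); rewrite ?rmorphM.
- by exists 1; rewrite ?rmorph1.
- by exists (-1); rewrite ?rmorphN1.
- by move=> _ [x _ <-]; exists x.
- by exists (-1); [exists (-1)|]; rewrite ?rmorphN1.
- exact/noeth_image/(IH h).
Qed.

(* With T the image of a power of g whose preimages of p = lann J have become
   stationary, an element c of J that is regular modulo p and lies in the
   preimage of p would make the sum of the T c ^+ i direct modulo p. *)
Lemma preim_atomic_stable (R : pzRingType) (g : {rmorphism R -> R}) (J : set R) :
  semiprime_ring R -> left_noetherian R ->
  (forall n (h : {rmorphism R -> R}), iter n g =1 h -> noeth (range h) setT) ->
  atomic_ideal J -> lann J `<=` g @^-1` lann J -> g @^-1` lann J `<=` lann J.
Proof.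
move=> sR nR ng aJ pg; apply: contrapT => npg.
have [iJ [j Jj j0] Jmin] := aJ; have ip := lann_ideal iJ.1.
have [[p0 pD pM] pMr] := ip; have [[_ JD JM] JMr] := iJ.
have iL := preim_ideal g ip; have [[L0 LD LM] LMr] := iL.
pose X := g @^-1` lann J `&` J; have iX : two_sided_ideal X := ideal_setI iL iJ.
have X0 : exists2 x, X x & x <> 0.
  apply: contrapT => h; apply: npg => x Lx y Jy.
  apply: contrapT => xy0; apply: h; exists (x * y) => //.
  by split; [apply: LMr|apply: JM].
have [c [Lc Jc] creg] := left_regular_in sR nR iX.1.
(* Here [X y] is killed by [c] and lies in [X], so it vanishes; semiprimeness gives [y X = 0], and
   atomicity passes from [X] to [J]. *)
have cann y : y * c = 0 -> lann J y.
  move=> yc; apply: (Jmin X) => //; first by move=> ? [].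
  have Xy z : X z -> z * y = 0.
    move=> Xz; apply: creg; last by rewrite -mulrA yc mulr0.
    by apply: iX.2.
  move=> z Xz; apply: (semiprime_elt sR) => r.
  have -> : y * z * r * (y * z) = y * (z * r * y) * z by rewrite !mulrA.
  by rewrite Xy ?mulr0 ?mul0r //; apply: iX.2.
have [|//||N hN] := noeth_setT nR (M := fun n => iter n g @^-1` lann J).
- move=> n; have [h gh] := iter_rmorphism g n.
  rewrite (_ : iter n g = h :> (R -> R)); last exact/funext.
  by apply/left_ideal_submod; case: (preim_ideal h ip).
- by move=> n x; apply: pg.
have [h gh] := iter_rmorphism g N.
(* By the choice of [N], the preimage of [p] meets [T] only inside [p]. *)
have Tp w : lann J (g (h w)) -> lann J (h w).
  by rewrite -gh => Lw; apply: (hN N.+1).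
(* In Horner form, the sum of the [T c ^+ i] for [i < k]. *)
pose M := fix M k := if k is k'.+1
  then [set z | exists t y, M k' y /\ z = h t + y * c] else [set 0] : set R.
have [|//||n hn] := ng N h gh M.
- elim=> [|k [M0 MD MM]].
    split=> //=; first by move=> x y -> ->; rewrite addr0.
    by move=> t x _ ->; rewrite mulr0.
  split=> /=.
  + by exists 0, 0; rewrite rmorph0 mul0r addr0.
  + move=> _ _ [t [y [My ->]]] [s [z [Mz ->]]]; exists (t + s), (y + z).
    by rewrite rmorphD mulrDl addrACA; split=> //; apply: MD.
  + move=> _ _ [s _ <-] [t [y [My ->]]]; exists (s * t), (h s * y).
    by rewrite rmorphM mulrDr mulrA; split=> //; apply: MM => //; exists s.
- elim=> [|k IH] /=; first by move=> _ ->; exists 0, 0; rewrite rmorph0 mul0r addr0.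
  by move=> _ [t [y [/IH My ->]]]; exists t, y.
have cM k : M k.+1 (c ^+ k).
  elim: k => [|k IH]; first by exists 1, 0; rewrite rmorph1 mul0r addr0.
  by exists 0, (c ^+ k); rewrite rmorph0 add0r exprSr.
(* Descent on [k]: the constant term [h t] falls into [p], then cancelling [c] lowers the exponent,
   until [1] would lie in [p]. *)
have cnM k y z : M k y -> lann J z -> c ^+ k = y + z -> False.
  elim: k y z => [|k IH] y z.
    move=> -> pz; rewrite expr0 add0r => z1.
    by apply: j0; rewrite -(mul1r j) z1; apply: pz.
  move=> [t [x [Mx ->]]] pz e.
  have e' : (c ^+ k - x) * c = h t + z.
    by rewrite mulrBl -exprSr e [_ + z]addrAC addrK.
  have pt : lann J (h t).
    apply: Tp; have -> : h t = (c ^+ k - x) * c + -1 * z by rewrite e' mulN1r addrK.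
    by apply: LD; [apply: LM|apply/LM/pg].
  have cx : (c ^+ k - x) * c = 0.
    by apply: (ideal_lann_trivial sR iJ.1); [rewrite e'; apply: pD|apply: JM].
  by apply: (IH x _ Mx (cann _ cx)); rewrite addrC subrK.
by apply: (cnM n (c ^+ n) 0) => //; [apply: (hn n.+1)|rewrite addr0].
Qed.

(** * Sequences of minimal primes and the conclusion *)

(** The intersections of tails stabilise at some [N]. Without repetition [J N] annihilates all later
    terms, hence itself. *)
Lemma atomic_repeats (R : pzRingType) (J : nat -> set R) :
  semiprime_ring R -> left_noetherian R -> (forall n, atomic_ideal (J n)) ->
  exists i k, lann (J (i + k.+1)%N) = lann (J i).
Proof.
move=> sR nR aJ; apply: contrapT => h.
pose C n := [set x | forall m, (n <= m)%N -> lann (J m) x].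
have [|//||N hN] := noeth_setT nR (M := C).
- move=> n; split=> /=.
  + by move=> m _; case: (lann_left_ideal (J m)).
  + move=> x y hx hy m nm; case: (lann_left_ideal (J m)) => _ pD _.
    by apply: pD; [apply: hx|apply: hy].
  + move=> a x _ hx m nm; case: (lann_left_ideal (J m)) => _ _ pM.
    by apply/pM/hx.
- by move=> n x hx m nm; apply/hx/ltnW.
have [iJ [x Jx x0] _] := aJ N; apply: x0.
apply: (ideal_lann_trivial sR iJ.1) => //; apply: (hN N.+1) => // m Nm y Jy.
apply: (atomic_orthogonal (aJ N) (aJ m)) => // e.
by apply: h; exists N, (m - N.+1)%N; rewrite addnS -addSn subnKC.
Qed.

Theorem theorem1p3 (R : pzRingType) (sigma : {rmorphism R -> R}) :
  semiprime_ring R -> left_noetherian R -> large_image sigma ->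
  injective sigma.
Proof.
move=> sR nR [I [eI If]]; apply: raddf_inj => x sx; apply: contrapT => x0.
have nf := noeth_large_image sR nR eI If.
(* The sequence starts inside the kernel; the aim is [J0] inside [lann J0]. *)
have [||J0 aJ0 J0K] := @atomic_exists R (sigma @^-1` [set 0]) nR.
- apply: preim_ideal; split; first split=> //=.
  + by move=> a b -> ->; rewrite addr0.
  + by move=> a b ->; rewrite mulr0.
  + by move=> a b /= ->; rewrite mul0r.
- by exists x.
have next J : exists J', atomic_ideal J ->
    atomic_ideal J' /\ lann J' `<=` sigma @^-1` lann J.
  have [aJ|] := pselect (atomic_ideal J); last by exists J.
  have [iJ [j Jj j0] _] := aJ.
  have [|||J' aJ' J'J] := @prime_contains_atomic R (sigma @^-1` lann J) sR nR.
  - exact/preim_ideal/lann_ideal/iJ.1.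
  - by rewrite /preimage /= rmorph1 => /(_ j Jj); rewrite mul1r.
  - by move=> a b; apply: (preim_atomic_prime sR nR eI).
  by exists J'.
have [phi hphi] := choice next; pose J n := iter n phi J0.
have aJ n : atomic_ideal (J n) by elim: n => //= n IH; case: (hphi _ IH).
have JS n : lann (J n.+1) `<=` sigma @^-1` lann (J n).
  by case: (hphi _ (aJ n)).
have Jiter k n : lann (J (n + k)%N) `<=` iter k sigma @^-1` lann (J n).
  elim: k => [|k IH] y; first by rewrite addn0.
  by rewrite addnS => /JS /IH; rewrite /preimage /= -iterSr.
(* By [Jiter], [lann (J n)] lies in its preimage under the iterate [g], hence equals it, and that
   preimage contains the left-hand side. *)
have back n k : lann (J (n + k.+1)%N) = lann (J n) ->
    sigma @^-1` lann (J (n + k)%N) `<=` lann (J n).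
  move=> e y /Jiter; rewrite /preimage /= -iterSr.
  have [g sg] := iter_rmorphism sigma k.+1; rewrite sg.
  apply: (preim_atomic_stable sR nR) => [m h gh||z].
  - apply: (@noeth_iter _ sigma nR nf (m * k.+1)%N) => z; rewrite -gh.
    by elim: m {gh} => [|m IH] //; rewrite mulSn iterD IH sg.
  - exact: aJ.
  - by rewrite -{1}e => /Jiter; rewrite /preimage /= -sg.
have [i [k e]] := atomic_repeats sR nR aJ.
(* By [back] and [JS], the preimages of the two terms one index earlier are nested, so these terms
   coincide too. *)
have {i e} e : lann (J (0 + k.+1)%N) = lann (J 0%N).
  elim: i e => // i IH e; apply: IH.
  rewrite addnS -addSn; apply: (preim_atomic_incomparable sR eI If) => //.
  exact: subset_trans (back _ _ e) (JS i).
have [iJ0 [y J0y y0] _] := aJ0; apply: y0.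
apply: (ideal_lann_trivial sR iJ0.1) => //; apply: (back _ _ e).
rewrite /preimage /= (J0K _ J0y); by case: (lann_left_ideal (J (0 + k)%N)).
Qed.
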